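(* Let $\rho:E\to\mathbb{R}$ be a convex quartic form, $\rho(x)=Q[x,x,x,x]$ with $Q:E^4\to\mathbb{R}$ a symmetric $4$-linear form, satisfying $\alpha^2\|x\|^4\le\rho(x)\le\beta^2\|x\|^4$ for all $x\in E$, where $0<\alpha\le\beta$. Then the function $g=\sqrt{\rho}$ is convex, differentiable on $E$, and has Lipschitz continuous gradient with constant $6\beta$, i.e. $\|\nabla g(x)-\nabla g(y)\|_*\le 6\beta\|x-y\|$ for all $x,y\in E$.
   Context: $E$ is a finite-dimensional Euclidean space with canonical pairing $\langle\cdot,\cdot\rangle$, and $\|\cdot\|$ is a Euclidean norm $\|x\|=\langle Bx,x\rangle^{1/2}$ induced by a self-adjoint positive definite operator $B:E\to E^*$. Gradients are measured in the dual norm $\|u\|_*=\langle u,B^{-1}u\rangle^{1/2}$. A symmetric $4$-linear form is a map $E^4\to\mathbb{R}$ that is linear in each variable and invariant under permutations of the variables. *)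

(* Defs.v *)
From HB Require Import structures.
From mathcomp Require Import all_boot all_order all_algebra all_fingroup.
From mathcomp Require Import all_classical all_reals all_analysis.

Set Implicit Arguments.
Unset Strict Implicit.
Unset Printing Implicit Defensive.

Import Order.TTheory GRing.Theory Num.Theory.
Import numFieldNormedType.Exports.

Local Open Scope ring_scope.
Local Open Scope classical_set_scope.

(* Finite-dimensional normed spaces.  The ambient norm `|x| serves only to give
   the space its topology (unique when K is real), hence differentiability; it is
   unrelated to the Euclidean norm [enorm] below. *)
#[short(type="normedVectType")]
HB.structure Definition NormedVector (K : numFieldType) :=
  {E of NormedModule K E & Vector K E}.

HB.instance Definition _ (K : numFieldType) (m n : nat) :=
  Vector.on 'M[K]_(m, n).

Section Euclidean.
Context {R : realType} {E : normedVectType R}.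

Definition dual := 'Hom(E, R).

Definition pairing (u : dual) (x : E) : R := u x.

Definition self_adjoint (B : 'Hom(E, dual)) : Prop :=
  forall x y : E, pairing (B x) y = pairing (B y) x.

Definition positive_definite (B : 'Hom(E, dual)) : Prop :=
  forall x : E, x != 0 -> 0 < pairing (B x) x.

Definition enorm (B : 'Hom(E, dual)) (x : E) : R :=
  Num.sqrt (pairing (B x) x).

(* [B^-1] is the linear-map inverse of vector.v; it is the two-sided inverse of
   [B] when [B] is positive definite, since then [B] is injective and
   [E] and [dual] have the same dimension. *)
Definition dual_norm (B : 'Hom(E, dual)) (u : dual) : R :=
  Num.sqrt (pairing u ((B^-1)%VF u)).

(* The Frechet derivative seen as an element of the dual; meaningful when [f] is
   differentiable at [x]. *)
Definition gradient (f : E -> R) (x : E) : dual := linfun ('d f x).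

End Euclidean.

Arguments dual {R} E.

Section Forms.
Context {R : realType} {E : lmodType R} {n : nat}.

Definition multilinear (Q : ('I_n -> E) -> R) : Prop :=
  forall (i : 'I_n) (x : 'I_n -> E) (a : R) (u v : E),
    Q [eta x with i |-> a *: u + v] =
      a * Q [eta x with i |-> u] + Q [eta x with i |-> v].

Definition permutation_invariant (Q : ('I_n -> E) -> R) : Prop :=
  forall (s : 'S_n) (x : 'I_n -> E), Q (x \o s) = Q x.

End Forms.

(* Main.v *)
(** Convexity of [rho] means [Q(x,x,h,h) >= 0].  Taking [x + h] and [x - h]
    and rescaling gives [Q(x,x,h,h) <= g x * g h], from which [g] lies above its
    tangents.  The quadratic upper bound
    [g (x + h) <= g x + g'(x) h + 3 g h] also follows algebraically from
    [Q(u,u,v,v) >= 0] for suitable [u], [v] in the span of [x] and [h].  As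
    [g h <= beta |h|^2], the two bounds squeeze [g] so tightly that it is
    differentiable, even at [0], and the usual cocoercivity argument turns them
    into the Lipschitz bound [6 beta] on the gradient. *)

From HB Require Import structures.
Require Import Defs.
From mathcomp Require Import all_boot all_order all_algebra all_fingroup.
From mathcomp Require Import all_classical all_reals all_analysis.
From mathcomp Require Import ring lra.

Set Implicit Arguments.
Unset Strict Implicit.
Unset Printing Implicit Defensive.

Import Order.TTheory GRing.Theory Num.Theory.
Import numFieldNormedType.Exports.

Local Open Scope ring_scope.
Local Open Scope classical_set_scope.

(** * Symmetric 4-linear forms with explicit arguments *)

Definition form4 (R : realType) (E : lmodType R) (Q : ('I_4 -> E) -> R)
    (a b c d : E) : R :=
  Q (fun i => nth 0 [:: a; b; c; d] i).

Section SymmetricForm.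
Context {R : realType} {E : lmodType R} (Q : ('I_4 -> E) -> R).
Context (Q_lin : multilinear Q) (Q_sym : permutation_invariant Q).
Local Notation q := (form4 Q).

Lemma form4_lin k a a' b c d :
  q (k *: a + a') b c d = k * q a b c d + q a' b c d.
Proof.
have qE z : q z b c d = Q [eta (fun i : 'I_4 => nth 0 [:: a; b; c; d] i) with
    (@Ordinal 4 0 isT) |-> z].
  by congr Q; apply/funext => -[[|[|[|[|i]]]] //= i4].
by rewrite !qE Q_lin.
Qed.

Let tpermE (n : nat) (s t i : 'I_n) :
  tperm s t i = (if i == s :> nat then t else if i == t :> nat then s else i).
Proof.
by case: tpermP => [->|->|/eqP + /eqP]; rewrite ?eqxx //;
  [case: eqP => [/val_inj->|] | rewrite -!val_eqE => /negPf-> /negPf->].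
Qed.

(** This and the next two adjacent transpositions generate all permutations of the arguments, so
    linearity in the first one spreads to the others. *)
Lemma form4C12 a b c d : q a b c d = q b a c d.
Proof.
rewrite /form4 -(Q_sym (tperm (@Ordinal 4 0 isT) (@Ordinal 4 1 isT))).
by congr Q; apply/funext => -[[|[|[|[|i]]]] //= i4]; rewrite tpermE.
Qed.

Lemma form4C23 a b c d : q a b c d = q a c b d.
Proof.
rewrite /form4 -(Q_sym (tperm (@Ordinal 4 1 isT) (@Ordinal 4 2 isT))).
by congr Q; apply/funext => -[[|[|[|[|i]]]] //= i4]; rewrite tpermE.
Qed.

Lemma form4C34 a b c d : q a b c d = q a b d c.
Proof.
rewrite /form4 -(Q_sym (tperm (@Ordinal 4 2 isT) (@Ordinal 4 3 isT))).
by congr Q; apply/funext => -[[|[|[|[|i]]]] //= i4]; rewrite tpermE.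
Qed.

Lemma form4_lin4 k a b c d d' :
  q a b c (k *: d + d') = k * q a b c d + q a b c d'.
Proof.
have C z : q a b c z = q z a b c by rewrite form4C34 form4C23 form4C12.
by rewrite !C form4_lin.
Qed.

Lemma form4_diag x : Q (fun=> x) = q x x x x.
Proof. by congr Q; apply/funext => -[[|[|[|[|i]]]] //= i4]. Qed.

(** The coefficients are the elementary symmetric polynomials in [a], [b], [c], [d]. Four
    independent scalars cover both [rho] along a line and [Q(u,u,v,v)] with [u], [v] in the span of
    [x] and [h]. *)
Lemma form4_expand x h a b c d :
  q (x + a *: h) (x + b *: h) (x + c *: h) (x + d *: h) =
    q x x x x + (a + b + c + d) * q x x x h
    + (a * b + a * c + a * d + b * c + b * d + c * d) * q x x h h
    + (a * b * c + a * b * d + a * c * d + b * c * d) * q x h h h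
    + a * b * c * d * q h h h h.
Proof.
have L1 t y z w : q (x + t *: h) y z w = q x y z w + t * q h y z w.
  by rewrite addrC form4_lin addrC.
have L2 t y z w : q y (x + t *: h) z w = q y x z w + t * q y h z w.
  by rewrite form4C12 L1 -!(form4C12 y).
have L3 t y z w : q y z (x + t *: h) w = q y z x w + t * q y z h w.
  by rewrite form4C23 L2 -!(form4C23 y z).
have L4 t y z w : q y z w (x + t *: h) = q y z w x + t * q y z w h.
  by rewrite form4C34 L3 -!(form4C34 y z w).
rewrite !(L1, L2, L3, L4).
(* Adjacent swaps sort every monomial, each [x] coming before each [h]. *)
rewrite !(form4C12 h x) !(form4C23 _ h x) !(form4C12 h x) !(form4C34 _ _ h x).
rewrite !(form4C23 _ h x) !(form4C12 h x).
ring.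
Qed.

End SymmetricForm.

(** * Tangent and quadratic bounds for the square root of a convex quartic form *)

Section ConvexQuarticForm.
Context {R : realType} {E : lmodType R} (Q : ('I_4 -> E) -> R).
Context (Q_lin : multilinear Q) (Q_sym : permutation_invariant Q).
Context (rho : E -> R) (rhoE : forall x, rho x = Q (fun=> x)).
Context (rho_convex : convex_function [set: E] rho).
Context (rho_gt0 : forall x, x != 0 -> 0 < rho x).
Local Notation q := (form4 Q).
Local Notation g x := (Num.sqrt (rho x)).

Let rho_diag x : rho x = q x x x x.
Proof. by rewrite rhoE form4_diag. Qed.

Let rho_line x h t : rho (x + t *: h) =
  rho x + 4 * t * q x x x h + 6 * t ^+ 2 * q x x h h
  + 4 * t ^+ 3 * q x h h h + t ^+ 4 * rho h.
Proof. by rewrite !rho_diag (form4_expand Q_lin Q_sym); ring. Qed.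

Let q0 a b c : q a b c 0 = 0.
Proof.
by rewrite -{1}(addr0 0) -{1}(scaler0 _ (-1)) form4_lin4 // mulN1r addNr.
Qed.

Let rho0 : rho 0 = 0. Proof. by rewrite rho_diag q0. Qed.

Let rho_ge0 x : 0 <= rho x.
Proof. by have [->|/rho_gt0/ltW//] := eqVneq x 0; rewrite rho0. Qed.

Let form4_sqr x : q x x x x = g x ^+ 2.
Proof. by rewrite sqr_sqrtr // rho_diag. Qed.

Let g0 : g 0 = 0. Proof. by rewrite rho0 sqrtr0. Qed.

Let g_gt0 x : x != 0 -> 0 < g x.
Proof. by move=> /rho_gt0; rewrite sqrtr_gt0. Qed.

(* Midpoint convexity on [x - t h, x + t h] gives
   [0 <= 12 t^2 Q(x,x,h,h) + 2 t^4 rho h] for all [t]. *)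
Lemma form4_xxhh_ge0 x h : 0 <= q x x h h.
Proof.
have [->|h0] := eqVneq h 0; first by rewrite q0.
have {}h0 := rho_gt0 h0; rewrite leNgt; apply/negP => c0.
(* If [Q(x,x,h,h)] were negative, this [t] would give [t^4 rho h = - t^2 Q(x,x,h,h)], and the
   midpoint inequality would become [0 <= 10 t^2 Q(x,x,h,h)]. *)
pose t := Num.sqrt (- q x x h h / rho h).
have t2 : t ^+ 2 = - q x x h h / rho h.
  by rewrite sqr_sqrtr // divr_ge0 ?ltW // oppr_gt0.
have half0 : 0 <= 2^-1 :> R by rewrite invr_ge0 ler0n.
have half1 : 2^-1 <= 1 :> R by rewrite invf_le1 ?ler1n ?ltr0n.
have := @rho_convex (Itv01 half0 half1) (x + t *: h) (x + (- t) *: h)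
  (in_setT _) (in_setT _).
have half : unstable.onem (2^-1) = 2^-1 :> R by rewrite /unstable.onem; field.
have -> : conv (Itv01 half0 half1) (x + t *: h : convex_lmodType E)
    (x + (- t) *: h) = x.
  rewrite /conv /= half -scalerDr scaleNr addrACA addrN addr0 scalerDr.
  by rewrite -scalerDl (_ : 2^-1 + 2^-1 = 1) ?scale1r //; field.
rewrite convRE /= half.
rewrite !rho_line.
have t4 : t ^+ 4 * rho h = - t ^+ 2 * q x x h h.
  by rewrite (exprM t 2 2) t2; field; rewrite gt_eqF.
have t2_gt0 : 0 < t ^+ 2 by rewrite t2 divr_gt0 // oppr_gt0.
have -> : (- t) ^+ 4 = t ^+ 4 by ring.
rewrite t4; nra.
Qed.

Lemma form4_xxhh_le x h : q x x h h <= g x * g h.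
Proof.
have [->|h0] := eqVneq h 0; first by rewrite q0 g0 mulr0.
have [->|x0] := eqVneq x 0.
  by rewrite -{1}(addr0 0) -{1}(scaler0 _ (-1)) form4_lin // mulN1r addNr
    g0 mul0r.
have A0 := g_gt0 x0; have H0 := g_gt0 h0.
(* This scaling makes [g (t h) = g x]; the mixed odd terms of [Q(x+th, x+th, x-th, x-th)] cancel. *)
pose t := Num.sqrt (g x / g h).
have t2 : t ^+ 2 = g x / g h by rewrite sqr_sqrtr // divr_ge0 ?ltW.
have := form4_xxhh_ge0 (x + t *: h) (x + (- t) *: h).
rewrite (form4_expand Q_lin Q_sym) !form4_sqr.
have -> : t * t * - t * - t = (t ^+ 2) ^+ 2 by ring.
have -> : t * t + t * - t + t * - t + t * - t + t * - t + - t * - t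
   = -2 * t ^+ 2 by ring.
have -> : t * t * - t + t * t * - t + t * - t * - t + t * - t * - t = 0 by ring.
have -> : t + t + - t + - t = 0 by ring.
rewrite t2 !mul0r !addr0.
have -> : g x ^+ 2 + -2 * (g x / g h) * q x x h h + (g x / g h) ^+ 2 * g h ^+ 2
  = 2 * (g x / g h) * (g x * g h - q x x h h) by field; rewrite gt_eqF.
by rewrite pmulr_rge0 ?subr_ge0 // mulr_gt0 ?divr_gt0.
Qed.

(* At [x = 0] the slope is a division by zero, hence [0], as it should be. *)
Definition slope x h : R := 2 * q x x x h / g x.

Lemma slope0l h : slope 0 h = 0.
Proof. by rewrite /slope g0 invr0 mulr0. Qed.

Lemma slope_lin x k h h' : slope x (k *: h + h') = k * slope x h + slope x h'.
Proof. by rewrite /slope form4_lin4 //; ring. Qed.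

(** Apply [Q(x,x,y,y) <= g x * g y] to [y = x + h], drop the nonnegative term [Q(x,x,h,h)] from the
    expansion of the left side, and divide by [g x]. *)
Lemma sqrt_form_ge x h : g x + slope x h <= g (x + h).
Proof.
have [->|x0] := eqVneq x 0.
  by rewrite slope0l g0 addr0 sqrtr_ge0.
have A0 := g_gt0 x0.
have := form4_xxhh_le x (x + 1 *: h).
(* The first two arguments are written [x + 0 *: h] to fit [form4_expand]. *)
rewrite -{1 2}(addr0 x) -{1 2}(scale0r h) (form4_expand Q_lin Q_sym).
have c0 := form4_xxhh_ge0 x h.
rewrite scale1r form4_sqr => le_AG.
rewrite -(ler_pM2l A0) mulrDr /slope mulrCA divff ?gt_eqF // mulr1.
apply: le_trans le_AG; lra.
Qed.

(* With [A = g x], [H = g h] and [Q(x^i h^j)] the value of [Q] at [i] copies of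
   [x] and [j] of [h], the difference of the squares of the two sides is
   [4 (Q(x^3 h)/A + H)^2 + (H/A) Q(u,u,v,v) + 4 (A H - Q(x^2 h^2)) (1 + H/A)],
   where [u] and [v] are the linear factors of [x^2 + 2 x h - (A/H) h^2]. *)
Lemma sqrt_form_le x h : g (x + h) <= g x + slope x h + 3 * g h.
Proof.
have [->|x0] := eqVneq x 0.
  by rewrite slope0l g0 !add0r; have := sqrtr_ge0 (rho h); lra.
have [->|h0] := eqVneq h 0.
  by rewrite /slope q0 g0 !(mulr0, mul0r) !addr0.
have A0 := g_gt0 x0; have H0 := g_gt0 h0.
have c_le := form4_xxhh_le x h.
have c_ge0 := form4_xxhh_ge0 x h.
(* Needed before comparing squares: [g x] times this quantity is at least [Q(x,x,x+h,x+h) >= 0],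
   because [Q(x,x,h,h) <= g x * g h]. *)
have rhs_ge0 : 0 <= g x + slope x h + 3 * g h.
  have := form4_xxhh_ge0 x (x + 1 *: h).
  rewrite -{1 2}(addr0 x) -{1 2}(scale0r h) (form4_expand Q_lin Q_sym).
  rewrite form4_sqr => ge0.
  rewrite -(pmulr_rge0 _ A0) !mulrDr /slope mulrCA divff ?gt_eqF // mulr1.
  have AH0 : 0 < g x * g h by exact: mulr_gt0.
  by move: AH0 c_le ge0; nra.
rewrite -(ger0_norm rhs_ge0) -sqrtr_sqr ler_wsqrtr //.
have -> : x + h = x + 1 *: h by rewrite scale1r.
rewrite rho_diag (form4_expand Q_lin Q_sym) !form4_sqr.
(* The factors are [u = x + (1 + s) h] and [v = x + (1 - s) h], since [1 - s^2 = - g x / g h]. *)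
pose s := Num.sqrt (1 + g x / g h).
have s2 : s ^+ 2 = 1 + g x / g h.
  by rewrite sqr_sqrtr // addr_ge0 // divr_ge0 ?ltW.
have := form4_xxhh_ge0 (x + (1 + s) *: h) (x + (1 - s) *: h).
rewrite (form4_expand Q_lin Q_sym) !form4_sqr.
set W := (W in 0 <= W -> _).
have -> : W = g x ^+ 2 + 4 * q x x x h + (4 - 2 * (g x / g h)) * q x x h h
    - 4 * (g x / g h) * q x h h h + (g x / g h) ^+ 2 * g h ^+ 2.
  rewrite [g x / g h](_ : _ = s ^+ 2 - 1) /W; last by rewrite s2; ring.
  by ring.
rewrite /slope; move: (g x) (g h) A0 H0 c_le {W s s2 rhs_ge0}.
move=> A H A0 H0 c_le W0.
rewrite -subr_ge0; set D := (D in 0 <= D).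
have -> : D = 4 * (q x x x h / A + H) ^+ 2
    + (H / A) * (A ^+ 2 + 4 * q x x x h + (4 - 2 * (A / H)) * q x x h h
        - 4 * (A / H) * q x h h h + (A / H) ^+ 2 * H ^+ 2)
    + 4 * (A * H - q x x h h) * (1 + H / A).
  by rewrite /D; field; rewrite !gt_eqF.
have HA0 : 0 <= H / A by rewrite divr_ge0 ?ltW.
apply: addr_ge0; first apply: addr_ge0; try exact: mulr_ge0.
  by rewrite mulr_ge0 ?sqr_ge0.
by rewrite !mulr_ge0 ?subr_ge0 ?addr_ge0.
Qed.

End ConvexQuarticForm.

(** * Boundedness in finite dimension, and differentiability from a quadratic error *)

(** Equivalence of norms: on the compact unit sphere of the coordinate space, the norm of the
    represented vector has a positive minimum, whose inverse serves as [C] by homogeneity. *)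
Lemma coord_vbasis_bounded (R : realType) (E : normedVectType R) :
  exists2 C : R, 0 < C & forall (x : E) i,
    `|coord (vbasis {:E}) i x| <= C * `|x|.
Proof.
set b := vbasis {:E}; set n := \dim {:E} in b *.
pose f (v : 'rV[R]_n) : E := \sum_i v ord0 i *: b`_i.
have fZ k v : f (k *: v) = k *: f v.
  by rewrite scaler_sumr; apply: eq_bigr => i _; rewrite mxE scalerA.
have coordf v i : coord b i (f v) = v ord0 i.
  exact/coord_sum_free/(basis_free (vbasisP _)).
have f_coord x : f (\row_i coord b i x) = x.
  rewrite [RHS](coord_vbasis (memvf x)).
  by apply: eq_bigr => i _; rewrite mxE.
have f_cont : continuous f.
  apply: continuous_big => [|i _]; first exact: add_continuous.
  have c : continuous (fun v : 'rV[R]_n => v ord0 i : R).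
    exact: coord_continuous.
  by move=> v; apply: (@cvgZr_tmp R E _ (nbhs v) (nbhs_filter v) _ _ _ (c v)).
have norm_cont : continuous (fun v => `|f v|).
  move=> v; apply: (@continuous_comp _ _ _ f Num.norm v); first exact: f_cont.
  exact: norm_continuous.
have le_coord (v : 'rV[R]_n) i : `|v ord0 i| <= `|v|.
  rewrite [leRHS]/Num.norm /= mx_normrE.
  by apply/bigmax_geP; right; exists (ord0, i).
pose S := [set v : 'rV[R]_n | `|v| = 1].
have S_compact : compact S.
  apply: bounded_closed_compact.
    by exists 1; split => // r r1 v /= ->; exact: ltW.
  rewrite (_ : S = (fun v : 'rV[R]_n => `|v|) @^-1` [set 1]) //.
  by apply: closed_comp => [v _|]; [exact: norm_continuous | exact: closed_eq].
have normS (v : 'rV[R]_n) : v != 0 -> S (`|v|^-1 *: v).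
  by move=> v0; rewrite /S /= normrZ normfV normr_id mulVf ?normr_eq0.
(* The sphere is empty in dimension zero, where there is no minimum to take. *)
have [S0|/set0P S0] := eqVneq S set0.
  exists 1 => // x i; rewrite -(f_coord x) coordf.
  have [->|/normS] := eqVneq (\row_i coord b i x) 0.
    by rewrite mxE normr0 mul1r.
  by rewrite S0.
have [c] := EVT_min_rV S0 S_compact (continuous_subspaceT norm_cont).
rewrite inE => cS c_min.
have c_gt0 : 0 < `|f c|.
  rewrite normr_gt0; apply/eqP => fc0.
  have c0 : c = 0.
    by apply/rowP => i; rewrite -coordf fc0 linear0 mxE.
  by move: cS; rewrite /S /= c0 normr0 => /eqP; rewrite eq_sym oner_eq0.
exists `|f c|^-1; first by rewrite invr_gt0.
move=> x i; rewrite -{2}(f_coord x); set v := \row_i _.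
have -> : coord b i x = v ord0 i by rewrite mxE.
apply: le_trans (le_coord v i) _.
have [->|v0] := eqVneq v 0; first by rewrite normr0 mulr_ge0 // invr_ge0.
have /mem_set/c_min := normS _ v0; rewrite fZ normrZ normfV normr_id.
by rewrite ler_pdivlMl ?normr_gt0 // mulrC -ler_pdivlMl // mulrC.
Qed.

Lemma linear_fun_bounded (R : realType) (E : normedVectType R)
    (f : {linear E -> R}) :
  exists2 C : R, 0 < C & forall x, `|f x| <= C * `|x|.
Proof.
have [C C0 CP] := coord_vbasis_bounded E.
(* The [+ 1] keeps the constant positive even when the sum vanishes. *)
exists (C * \sum_(i < \dim {:E}) `|f (vbasis {:E})`_i| + 1).
  by rewrite ltr_wpDl // mulr_ge0 ?sumr_ge0 // ltW.
move=> x; rewrite {1}(coord_vbasis (memvf x)) linear_sum.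
apply: le_trans (ler_norm_sum _ _ _) _.
rewrite mulrDl mul1r ler_wpDr // mulrAC mulr_sumr ler_sum // => i _.
by rewrite linearZ normrM ler_wpM2r.
Qed.

Lemma linear_fun_continuous (R : realType) (E : normedVectType R)
  (f : {linear E -> R}) : continuous f.
Proof.
have [C C0 CP] := linear_fun_bounded f.
apply/bounded_linear_continuous/linear_boundedP.
exists C; split => [|r /ltW Cr x]; first exact: num_real.
by apply: le_trans (CP x) _; rewrite ler_wpM2r.
Qed.

(** Converts an error quadratic in the Euclidean norm into one quadratic in the ambient norm, in
    which differentiability is expressed. *)
Lemma enorm_bounded (R : realType) (E : normedVectType R)
    (B : 'Hom(E, dual E)) :
  exists2 C : R, 0 < C & forall x, `|pairing (B x) x| <= C * `|x| ^+ 2.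
Proof.
have [C C0 CP] := coord_vbasis_bounded E.
set b := vbasis {:E} in CP.
pose K i := sval (cid2 (linear_fun_bounded (B b`_i))).
have [K0 KP] : (forall i, 0 < K i) /\
    forall i x, `|B b`_i x| <= K i * `|x|.
  by split => i; rewrite /K; case: cid2.
exists (C * \sum_(i < \dim {:E}) K i + 1).
  by rewrite ltr_wpDl // mulr_ge0 ?sumr_ge0 // => [|i _]; exact: ltW.
move=> x; rewrite /pairing {1}(coord_vbasis (memvf x)) linear_sum sum_lfunE.
apply: le_trans (ler_norm_sum _ _ _) _.
rewrite mulrDl mul1r ler_wpDr ?sqr_ge0 // mulrAC mulr_sumr ler_sum // => i _.
rewrite linearZ scale_lfunE normrM.
apply: le_trans (ler_pM _ _ (CP x i) (KP i x)) _ => //.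
by rewrite le_eqVlt; apply/orP; left; apply/eqP; ring.
Qed.

Lemma differentiable_sandwich (R : realType) (E : normedVectType R)
    (f : E -> R) (l : {linear E -> R}) (x : E) (C : R) :
  (forall h, `|f (x + h) - f x - l h| <= C * `|h| ^+ 2) ->
  differentiable f x /\ 'd f x = l :> (E -> R).
Proof.
move=> fP.
have fE : f \o shift x = cst (f x) + l +o_ 0 id.
  apply/eqaddoP => e e0; near=> h.
  have -> : (f \o shift x - (cst (f x) + l)) h = f (x + h) - f x - l h.
    by rewrite [x + h]addrC -addrA -opprD.
  apply: le_trans (fP h) _; rewrite expr2 mulrA ler_wpM2r //.
  (* This denominator is positive whatever the sign of [C]. *)
  have C1 : 0 < `|C| + 1 by rewrite ltr_wpDl.
  have : `|h| <= e / (`|C| + 1).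
    by near: h; apply: nbhs0_le; rewrite divr_gt0.
  rewrite ler_pdivlMr //; apply: le_trans.
  by rewrite mulrC ler_wpM2l // (le_trans (ler_norm C)) // lerDl.
have lc := @linear_fun_continuous R E l.
have dE := diff_unique lc fE.
by split => //; apply/diff_locallyP; rewrite dE.
Unshelve. all: by end_near. Qed.

(** * Dual norm and the Lipschitz bound on slopes *)

Section Duality.
Context {R : realType} {E : normedVectType R} (B : 'Hom(E, dual E)).
Context (B_adj : self_adjoint B) (B_pos : positive_definite B).

Lemma pairing_ge0 x : 0 <= pairing (B x) x.
Proof.
by have [->|/B_pos/ltW//] := eqVneq x 0; rewrite [pairing _ _]linear0.
Qed.

Let dualP (u : dual E) k z t : u (k *: z + t) = k * u z + u t.
Proof. exact: linearP. Qed.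

Let dualZ (u : dual E) k z : u (k *: z) = k * u z.
Proof. exact: linearZ. Qed.

Let scaleE k (u : dual E) z : (k *: u) z = k * u z.
Proof. exact: scale_lfunE. Qed.

Let pairingZ k l x y :
  pairing (B (k *: x)) (l *: y) = k * l * pairing (B x) y.
Proof.
by rewrite /pairing dualZ [B _]linearZ scaleE mulrCA mulrA.
Qed.

(** Positivity makes the kernel of [B] trivial; equality of dimensions then makes [B] surjective. *)
Lemma positive_definite_invK u : B ((B^-1)%VF u) = u.
Proof.
apply: limg_lfunVK; suff -> : limg B = fullv by exact: memvf.
apply/eqP; rewrite eqEdim subvf limg_dim_eq ?dimvf /dim /= ?muln1 //.
apply/eqP; rewrite -subv0; apply/subvP => x /memv_capP[_].
rewrite memv_ker memv0 => /eqP Bx0; apply: contraT => /B_pos.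
by rewrite /pairing Bx0 zero_lfunE ltxx.
Qed.

(* Cocoercivity: minimising over [k] the gap between the tangent of [g] at [x]
   and the quadratic upper bound based at [y] bounds the dual norm of the
   difference of the slopes. *)
Lemma dual_norm_lipschitz (g : E -> R) (D : E -> dual E) (L : R) :
  0 < L ->
  (forall x h, g x + D x h <= g (x + h)) ->
  (forall x h, g (x + h) <= g x + D x h + L / 2 * pairing (B h) h) ->
  forall x y, dual_norm B (D x - D y) <= L * enorm B (x - y).
Proof.
move=> L0 gl gu x y; rewrite /dual_norm /enorm.
set u := D x - D y; set w := (B^-1)%VF u.
have Bw : B w = u by exact: positive_definite_invK.
have uE z : pairing (B w) z = D x z - D y z.
  by rewrite Bw /pairing /u add_lfunE opp_lfunE.
have -> : pairing u w = pairing (B w) w by rewrite Bw.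
set N := pairing (B w) w; set d := x - y.
(* Both sides estimate [g (y' + s w)]: from below by the tangent at [x'], from above by the
   quadratic bound at [y']. *)
have gap x' y' (s : R) : g x' + D x' (y' - x') + s * (D x' w - D y' w)
    <= g y' + L / 2 * s ^+ 2 * N.
  have := gl x' (y' - x' + s *: w); have := gu y' (s *: w).
  have -> : x' + (y' - x' + s *: w) = y' + s *: w by rewrite addrA subrKC.
  rewrite pairingZ -/N dualZ [y' - x' + _]addrC dualP; lra.
have Nd : N <= L * pairing (B w) d.
  have NE : N = D x w - D y w := uE w.
  have Dyx (v : dual E) : v (y - x) = - v d by rewrite -opprB; exact: linearN.
  (* The optimal steps are [1 / L] and, with [x] and [y] exchanged, [- 1 / L]. Adding the two
     inequalities cancels the values of [g]. *)
  have := gap x y L^-1; have := gap y x (- L^-1).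
  rewrite Dyx -/d -[D y w - D x w]opprB -NE mulrNN uE.
  have -> : L / 2 * (- L^-1) ^+ 2 * N = L^-1 * N / 2 by field; rewrite gt_eqF.
  have -> : L / 2 * L^-1 ^+ 2 * N = L^-1 * N / 2 by field; rewrite gt_eqF.
  by rewrite -ler_pdivrMl //; lra.
(* In place of Cauchy-Schwarz, expand [0 <= <B(w - L d), w - L d>] and insert [Nd]. *)
have N_le : N <= L ^+ 2 * pairing (B d) d.
  have := pairing_ge0 (w + (- L) *: d).
  rewrite [w + _]addrC {1}/pairing [B _]linearP add_lfunE !dualP !scaleE /=.
  rewrite -!/(pairing _ _) (B_adj d w) -/N.
  by move: Nd; lra.
rewrite -[X in _ <= X * _](ger0_norm (ltW L0)) -sqrtr_sqr -sqrtrM ?sqr_ge0 //.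
exact: ler_wsqrtr.
Qed.

End Duality.

(** * Convexity from tangents, and assembly of the bounds *)

(** Average the tangent at the convex combination [z], evaluated at [x] and [y]; the linear terms
    cancel because the weighted sum of [x - z] and [y - z] is zero. *)
Lemma convex_function_subgradient (R : realType) (E : lmodType R)
    (f : E -> R) (l : E -> {linear E -> R}) :
  (forall x h, f x + l x h <= f (x + h)) -> convex_function [set: E] f.
Proof.
move=> fP t x y _ _; set z := conv t x y.
have s0 : 0 <= t%:num :> R by [].
have s1 : 0 <= unstable.onem t%:num :> R by rewrite subr_ge0.
rewrite convRE; set s := t%:num in s0 s1 *.
have zE : z = s *: (x : E) + unstable.onem s *: (y : E) by [].
have := fP z (x - z); have := fP z (y - z).
rewrite !subrKC => /(ler_wpM2l s1) fy /(ler_wpM2l s0) fx.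
apply: le_trans (lerD fx fy).
rewrite !mulrDr addrACA -mulrDl [s + _]addrC subrK mul1r lerDl.
have lZ k v : k * l z v = l z (k *: v) by rewrite linearZ.
rewrite !lZ -linearD !scalerBr addrACA -zE -opprD -scalerDl.
by rewrite [s + _]addrC subrK scale1r subrr linear0.
Qed.

Theorem proposition3p2 (R : realType) (E : normedVectType R)
    (B : 'Hom(E, dual E))
    (B_adj : self_adjoint B) (B_pos : positive_definite B)
    (Q : ('I_4 -> E) -> R)
    (Q_lin : multilinear Q) (Q_sym : permutation_invariant Q)
    (rho : E -> R) (rhoE : forall x : E, rho x = Q (fun=> x))
    (rho_convex : convex_function [set: E] rho)
    (alpha beta : R) (alpha_gt0 : 0 < alpha) (le_alpha_beta : alpha <= beta)
    (rho_bounds : forall x : E,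
      alpha ^+ 2 * enorm B x ^+ 4 <= rho x <= beta ^+ 2 * enorm B x ^+ 4) :
  let g := fun x : E => Num.sqrt (rho x) in
  [/\ convex_function [set: E] g,
      forall x : E, differentiable g x &
      forall x y : E,
        dual_norm B (gradient g x - gradient g y) <= 6 * beta * enorm B (x - y)].
Proof.
move=> g.
have beta_gt0 : 0 < beta by exact: lt_le_trans le_alpha_beta.
have sqr_enorm x : enorm B x ^+ 2 = pairing (B x) x.
  by rewrite sqr_sqrtr // pairing_ge0.
have rho_gt0 x : x != 0 -> 0 < rho x.
  move=> x0; case/andP: (rho_bounds x) => + _; apply: lt_le_trans.
  by rewrite mulr_gt0 ?exprn_gt0 // sqrtr_gt0 B_pos.
have g_le x : g x <= beta * pairing (B x) x.
  rewrite -sqr_enorm.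
  have -> : beta * enorm B x ^+ 2 = Num.sqrt ((beta * enorm B x ^+ 2) ^+ 2).
    by rewrite sqrtr_sqr ger0_norm // mulr_ge0 ?sqr_ge0 // ltW.
  apply: ler_wsqrtr; rewrite exprMn -exprM.
  by case/andP: (rho_bounds x).
pose l x : {linear E -> R} := HB.pack (slope Q rho x)
  (GRing.isLinear.Build R E R _ (slope Q rho x) (slope_lin Q_lin Q_sym rho x)).
have g_ge x h : g x + l x h <= g (x + h).
  exact: (sqrt_form_ge Q_lin Q_sym rhoE rho_convex rho_gt0).
(* The coefficient [3 * beta] is [L / 2] for the Lipschitz constant [L = 6 * beta]. *)
have g_ub x h : g (x + h) <= g x + l x h + 3 * beta * pairing (B h) h.
  apply: le_trans (sqrt_form_le Q_lin Q_sym rhoE rho_convex rho_gt0 x h) _.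
  by apply: lerD => //; rewrite -mulrA ler_wpM2l //; exact: g_le.
have g_diff x : differentiable g x /\ 'd g x = l x :> (E -> R).
  have [C C0 CP] := enorm_bounded B.
  apply: (@differentiable_sandwich R E g (l x) x (3 * beta * C)) => h.
  (* By [g_ge] the error is nonnegative, so the upper bound alone controls its absolute value. *)
  rewrite -addrA -opprD ger0_norm ?subr_ge0 // lerBlDl.
  apply: le_trans (g_ub x h) _; apply: lerD => //.
  rewrite -[leRHS]mulrA; apply: ler_wpM2l; first by rewrite mulr_ge0 // ltW.
  exact: le_trans (ler_norm _) (CP h).
have gradE x h : gradient g x h = l x h.
  by rewrite lfunE /= (g_diff x).2.
split; first exact: convex_function_subgradient g_ge.
  by move=> x; case: (g_diff x).
apply: dual_norm_lipschitz => // [|x h|x h]; first by rewrite mulr_gt0.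
  by rewrite gradE.
by rewrite gradE; have -> : 6 * beta / 2 = 3 * beta by field.
Qed.
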